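(* Let $p$ be a positive integer, let $H$ be an arbitrary graph with $h=|V(H)|\ge 1$ vertices, and let $\ell=r(K_p,H)$. Then $K_1+nH$ is $p$-good, i.e. $$r(K_p,K_1+nH)=(p-1)(nh+1-1)+1=(p-1)nh+1,$$ provided one of the following conditions holds: (1) $n\ge 2p\ell/h$; (2) $n\ge \max\{(p+2)\ell/h,\ \ell-h\}$.
   Context: For graphs $G_1,G_2$, the Ramsey number $r(G_1,G_2)$ is the smallest positive integer $N$ such that for every graph $G$ on $N$ vertices, either $G$ contains $G_1$ as a subgraph or the complement $\overline{G}$ contains $G_2$ as a subgraph. $K_p$ denotes the complete graph on $p$ vertices. A connected graph $F$ is called $p$-good if $r(K_p,F)=(p-1)(|V(F)|-1)+1$. For a graph $H$ and positive integer $n$, $nH$ denotes the disjoint union of $n$ copies of $H$, and the generalized fan $K_1+nH$ is the graph obtained from $nH$ by adding one new vertex adjacent to every vertex of $nH$ (so $|V(K_1+nH)|=nh+1$). *)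

(* Defs.v *)
(* boolp is used only to turn a Prop into the boolean predicate expected by
   ex_minn. *)
From mathcomp Require Import all_boot.
From mathcomp Require Import boolp.

Set Implicit Arguments.
Unset Strict Implicit.
Unset Printing Implicit Defensive.

Record sgraph := SGraph {
  vertex :> finType;
  adj : rel vertex;
  adj_sym : symmetric adj;
  adj_irrefl : irreflexive adj }.

Definition compl_adj (G : sgraph) : rel G := fun x y => (x != y) && ~~ adj x y.

Lemma compl_adj_sym (G : sgraph) : symmetric (@compl_adj G).
Proof. by move=> x y; rewrite /compl_adj eq_sym adj_sym. Qed.

Lemma compl_adj_irrefl (G : sgraph) : irreflexive (@compl_adj G).
Proof. by move=> x; rewrite /compl_adj eqxx. Qed.

Definition complement (G : sgraph) : sgraph :=
  SGraph (@compl_adj_sym G) (@compl_adj_irrefl G).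

Definition complete_adj (p : nat) : rel 'I_p := fun x y => x != y.

Lemma complete_adj_sym (p : nat) : symmetric (@complete_adj p).
Proof. by move=> x y; rewrite /complete_adj eq_sym. Qed.

Lemma complete_adj_irrefl (p : nat) : irreflexive (@complete_adj p).
Proof. by move=> x; rewrite /complete_adj eqxx. Qed.

Definition complete (p : nat) : sgraph :=
  SGraph (@complete_adj_sym p) (@complete_adj_irrefl p).

(* The vertex (i, v) of nH is the vertex v in the i-th copy of H. *)
Definition copies_adj (n : nat) (H : sgraph) : rel ('I_n * H) :=
  fun x y => (x.1 == y.1) && adj x.2 y.2.

Lemma copies_adj_sym (n : nat) (H : sgraph) : symmetric (@copies_adj n H).
Proof. by move=> x y; rewrite /copies_adj eq_sym adj_sym. Qed.

Lemma copies_adj_irrefl (n : nat) (H : sgraph) : irreflexive (@copies_adj n H).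
Proof. by move=> x; rewrite /copies_adj adj_irrefl andbF. Qed.

Definition copies (n : nat) (H : sgraph) : sgraph :=
  SGraph (@copies_adj_sym n H) (@copies_adj_irrefl n H).

(* K_1 + G: the new vertex is None. *)
Definition cone_adj (G : sgraph) : rel (option G) := fun x y =>
  match x, y with
  | Some u, Some v => adj u v
  | None, None => false
  | _, _ => true
  end.

Lemma cone_adj_sym (G : sgraph) : symmetric (@cone_adj G).
Proof. by move=> [x|] [y|] //=; apply: adj_sym. Qed.

Lemma cone_adj_irrefl (G : sgraph) : irreflexive (@cone_adj G).
Proof. by move=> [x|] //=; apply: adj_irrefl. Qed.

Definition cone (G : sgraph) : sgraph :=
  SGraph (@cone_adj_sym G) (@cone_adj_irrefl G).

Definition connected (G : sgraph) : Prop :=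
  0 < #|G| /\ forall x y : G, connect (@adj G) x y.

(* Subgraph containment, not necessarily induced. *)
Definition contains (G F : sgraph) : Prop :=
  exists2 f : F -> G, injective f & forall x y, adj x y -> adj (f x) (f y).

Definition arrows (G1 G2 : sgraph) (N : nat) : Prop :=
  forall G : sgraph, #|G| = N -> contains G G1 \/ contains (complement G) G2.

Definition is_ramsey (G1 G2 : sgraph) : pred nat :=
  fun N => (0 < N) && `[< arrows G1 G2 N >].

(* Ramsey's theorem, needed for ramsey_number to be well defined. *)
Lemma ramsey_sets (a b : nat) : exists N, forall (G : sgraph) (A : {set G}),
  N <= #|A| ->
  (exists B : {set G}, [/\ B \subset A, #|B| = a &
     {in B &, forall x y, x != y -> adj x y}]) \/
  (exists B : {set G}, [/\ B \subset A, #|B| = b &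
     {in B &, forall x y, x != y -> ~~ adj x y}]).
Proof.
elim: a b => [|a IHa] b.
  exists 0 => G A _; left; exists set0; rewrite sub0set cards0; split=> //.
  by move=> x y; rewrite inE.
elim: b => [|b [N2 IH2]].
  exists 0 => G A _; right; exists set0; rewrite sub0set cards0; split=> //.
  by move=> x y; rewrite inE.
have [N1 IH1] := IHa b.+1.
exists (N1 + N2).+1 => G A leNA.
have /card_gt0P[v vA] : 0 < #|A| by apply: leq_trans leNA.
have cardv : N1 + N2 <= #|A :\ v| by move: leNA; rewrite (cardsD1 v A) vA ltnS.
pose X := [set x in A :\ v | adj v x].
pose Y := [set x in A :\ v | ~~ adj v x].
have cardXY : #|X| + #|Y| = #|A :\ v|.
  rewrite -(cardsID [set x | adj v x] (A :\ v)); congr (_ + _);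
    by apply: eq_card => x; rewrite !inE // andbC.
have subX : X \subset A by apply/subsetP=> x; rewrite !inE => /andP[/andP[]].
have subY : Y \subset A by apply/subsetP=> x; rewrite !inE => /andP[/andP[]].
have [leX|ltX] := leqP N1 #|X|.
  have [[B [sB cB hB]]|[B [sB cB hB]]] := IH1 G X leX; last first.
    by right; exists B; split=> //; apply: subset_trans subX.
  have BX x : x \in B -> x != v /\ adj v x.
    by move=> /(subsetP sB); rewrite !inE => /andP[/andP[-> _] ->].
  left; exists (v |: B); split.
  - by rewrite subUset sub1set vA (subset_trans sB subX).
  - by rewrite cardsU1 cB; case: (boolP (v \in B)) => // /BX[]; rewrite eqxx.
  - move=> x y /setU1P[->|xB] /setU1P[->|yB]; rewrite ?eqxx //.
    + by have [] := BX _ yB.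
    + by rewrite adj_sym; have [] := BX _ xB.
    + exact: hB.
have leY : N2 <= #|Y|.
  by rewrite leqNgt; apply/negP => ltY; move: cardv;
    rewrite -cardXY leqNgt -addSn leq_add // ltnW.
have [[B [sB cB hB]]|[B [sB cB hB]]] := IH2 G Y leY.
  by left; exists B; split=> //; apply: subset_trans subY.
have BY x : x \in B -> x != v /\ ~~ adj v x.
  by move=> /(subsetP sB); rewrite !inE => /andP[/andP[-> _] ->].
right; exists (v |: B); split.
- by rewrite subUset sub1set vA (subset_trans sB subY).
- by rewrite cardsU1 cB; case: (boolP (v \in B)) => // /BY[]; rewrite eqxx.
- move=> x y /setU1P[->|xB] /setU1P[->|yB]; rewrite ?eqxx //.
  + by have [] := BY _ yB.
  + by rewrite adj_sym; have [] := BY _ xB.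
  + exact: hB.
Qed.

Lemma contains_clique (G F : sgraph) (B : {set G}) : #|B| = #|F| ->
  {in B &, forall x y, x != y -> adj x y} -> contains G F.
Proof.
move=> cB hB; pose f (x : F) : G := enum_val (cast_ord (esym cB) (enum_rank x)).
have fB x : f x \in B by apply: enum_valP.
have f_inj : injective f.
  by move=> x y /enum_val_inj/cast_ord_inj/enum_rank_inj.
exists f => // x y xy; apply: hB => //; rewrite (inj_eq f_inj).
by apply: contraTneq xy => ->; rewrite adj_irrefl.
Qed.

Lemma ramsey_exists (G1 G2 : sgraph) : exists N, is_ramsey G1 G2 N.
Proof.
have [N hN] := ramsey_sets #|G1| #|G2|.
exists N.+1; rewrite /is_ramsey /=; apply/asboolP => G cG.
have /hN : N <= #|[set: G]| by rewrite cardsT cG.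
case=> -[B [_ cB hB]]; [left | right]; first exact: contains_clique cB hB.
apply: (@contains_clique (complement G) G2 B cB) => x y xB yB xy.
by rewrite /= /compl_adj xy hB.
Qed.

Definition ramsey_number (G1 G2 : sgraph) : nat := ex_minn (ramsey_exists G1 G2).

Definition p_good (p : nat) (F : sgraph) : Prop :=
  connected F /\ ramsey_number (complete p) F = p.-1 * #|F|.-1 + 1.

(* Main.v *)
(* Put m = n * h and d = l - h, and suppose that a graph with more than q * m
   vertices (q = p - 1) is K_p-free while no closed non-neighbourhood D(v)
   contains, besides v, a copy of nH in the complement; add edges until it is
   edge-maximal K_p-free. Packing H greedily gives |D(v)| <= m + d, and
   induction on q bounds every K_{k+1}-free set with k < q by k * m vertices.
   Hence D(x) and D(z) share at most 2d - 1 vertices if x and z are adjacent,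
   whereas, by maximality, they share more than m - (q - 1) * d vertices if x
   and z are not adjacent.
   If m >= 2(q + 1)d, these bounds make non-adjacency transitive. If only
   m >= (q + 3)d, then double counting over a q-clique Q yields a v in Q such
   that the set R of the vertices of D(v) having another non-neighbour in Q
   satisfies |R| < 2|D(v)| - 2m; the rest V of D(v) is independent and, by the
   same bounds, no vertex of R has a neighbour in V. Since n >= d, all the
   vertices of R that are needed can be placed in distinct copies of H, the
   remaining vertices of which are taken from V. *)
Require Import Defs.
From mathcomp Require Import all_boot all_order all_algebra.
From mathcomp Require Import zify boolp.

Import Order.TTheory GRing.Theory Num.Theory.

Set Implicit Arguments.
Unset Strict Implicit.
Unset Printing Implicit Defensive.

(** * Cliques and non-neighbourhoods of a relation on a fixed vertex type, so that subsets and added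
    edges need no change of type *)

Section Cliques.
Variables (T : finType) (e : rel T).
Hypotheses (e_sym : symmetric e) (e_irr : irreflexive e).
Implicit Types (S X Y P V R : {set T}) (u v w x y z : T).

Definition clique S : bool := [forall x in S, forall y in S, (x != y) ==> e x y].

Definition clique_free k X : Prop :=
  forall S, S \subset X -> clique S -> #|S| < k.

Definition nonnbrs X v : {set T} := [set u in X | ~~ e v u].

Definition common_nbrs X S : {set T} := [set u in X | [forall v in S, e v u]].

Lemma cliqueP S : reflect {in S &, forall x y, x != y -> e x y} (clique S).
Proof.
apply: (iffP forall_inP) => [cS x y xS yS xy | cS x xS].
  by have /forall_inP/(_ y yS)/implyP-> := cS x xS.
by apply/forall_inP => y yS; apply/implyP; apply: cS.
Qed.

Lemma clique_sub S S' : S' \subset S -> clique S -> clique S'.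
Proof.
move=> sS /cliqueP cS; apply/cliqueP => x y /(subsetP sS) xS /(subsetP sS).
exact: cS.
Qed.

Lemma cliqueU S S' : clique S -> clique S' ->
  {in S & S', forall x y, e x y} -> clique (S :|: S').
Proof.
move=> /cliqueP cS /cliqueP cS' cSS'; apply/cliqueP => x y.
move=> /setUP[xS|xS] /setUP[yS|yS] xy; first exact: cS.
- exact: cSS'.
- by rewrite e_sym; apply: cSS'.
- exact: cS'.
Qed.

Lemma clique1 x : clique [set x].
Proof. by apply/cliqueP => y z /set1P-> /set1P->; rewrite eqxx. Qed.

Lemma clique2 x y : e x y -> clique [set x; y].
Proof.
move=> exy; apply: cliqueU; rewrite ?clique1 //.
by move=> ? ? /set1P-> /set1P->.
Qed.

Lemma mem_nonnbrs_self X v : v \in X -> v \in nonnbrs X v.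
Proof. by rewrite inE e_irr => ->. Qed.

Lemma common_nbrs_sub X S : common_nbrs X S \subset X.
Proof. by apply/subsetP => u; rewrite inE => /andP[]. Qed.

Lemma common_nbrsP X S u :
  reflect (u \in X /\ {in S, forall v, e v u}) (u \in common_nbrs X S).
Proof. by rewrite inE; apply: (iffP andP) => -[uX /forall_inP]. Qed.

Lemma clique_free_sub k X Y : Y \subset X -> clique_free k X -> clique_free k Y.
Proof. by move=> sYX fX S sS; apply: fX; apply: subset_trans sYX. Qed.

Lemma clique_free_leq k k' X : k <= k' -> clique_free k X -> clique_free k' X.
Proof. by move=> kk' fX S sS cS; apply: leq_trans kk'; apply: fX. Qed.

(** A clique in the common neighbourhood extends [S] to a larger clique, and irreflexivity makes the
    two disjoint, so their sizes add up. *)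
Lemma clique_free_common_nbrs k X S : S \subset X -> clique S ->
  clique_free (#|S| + k) X -> clique_free k (common_nbrs X S).
Proof.
move=> sSX cS fX S' sS' cS'.
have SS' : {in S & S', forall x y, e x y}.
  by move=> x y xS /(subsetP sS')/common_nbrsP[_]; apply.
have := fX (S :|: S'); rewrite cardsU (_ : S :&: S' = set0) ?cards0 ?subn0.
  rewrite ltn_add2l; apply; last exact: cliqueU.
  by rewrite subUset sSX (subset_trans sS') ?common_nbrs_sub.
apply/setP => x; rewrite !inE; apply/negP => /andP[xS xS'].
by have := SS' x x xS xS'; rewrite e_irr.
Qed.

Lemma clique_free2_indep Y : clique_free 2 Y -> {in Y &, forall x y, ~~ e x y}.
Proof.
move=> fY x y xY yY; apply/negP => exy; have := fY [set x; y].
rewrite clique2 // cards2 subUset !sub1set xY yY => /(_ isT isT).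
by case: eqP exy => // ->; rewrite e_irr.
Qed.

Lemma common_nbrs_cover X S :
  X = common_nbrs X S :|: \bigcup_(v in S) nonnbrs X v.
Proof.
apply/setP => u; rewrite in_setU; case: (boolP (u \in X)) => [uX|nuX]; last first.
  apply/esym/norP; split; first by rewrite inE (negbTE nuX).
  by apply/bigcupP => -[v _]; rewrite inE (negbTE nuX).
apply/esym/orP; case: (boolP (u \in common_nbrs X S)) => [|nu]; [by left|right].
move: nu; rewrite inE uX /= negb_forall => /existsP[v].
rewrite negb_imply => /andP[vS nev]; apply/bigcupP; exists v => //.
by rewrite inE uX.
Qed.

Lemma card_bigcup_nonnbrs X S b : {in S, forall v, #|nonnbrs X v| <= b} ->
  #|\bigcup_(v in S) nonnbrs X v| <= #|S| * b.
Proof.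
move=> bS; rewrite -sum_nat_const.
apply: (@leq_trans (\sum_(v in S) #|nonnbrs X v|)); last exact: leq_sum.
elim/big_rec2: _ => [|v a b' vS IH]; first by rewrite cards0.
by rewrite (leq_trans (leq_card_setU _ _)) // leq_add2l.
Qed.

End Cliques.

(** * Structure of an edge-maximal counterexample *)

Section NearlyIndependentNonneighbourhood.
Variables (T : finType) (e : rel T) (X : {set T}) (q m d : nat).
Hypotheses (e_sym : symmetric e) (e_irr : irreflexive e).
Hypotheses (q_gt0 : 0 < q) (X_free : clique_free e q.+1 X) (X_gt : q * m < #|X|).
Hypothesis nonnbrs_leq : {in X, forall v, #|nonnbrs e X v| <= m + d}.
Hypothesis card_leq : forall k (Y : {set T}),
  k < q -> Y \subset X -> clique_free e k.+1 Y -> #|Y| <= k * m.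
Hypothesis X_max : {in X &, forall x y, x != y -> ~~ e x y ->
  exists P : {set T}, [/\ P \subset X, clique e P, #|P| = q.-1,
    {in P, forall v, e v x} & {in P, forall v, e v y}]}.
Hypothesis d_small : q.+3 * d <= m.
Implicit Types (S : {set T}) (u v w x y z : T).
Local Notation D := (nonnbrs e X).

(** The common neighbourhood of [S] has no clique of [q - #|S| + 1] vertices, hence at most
    [(q - #|S|) * m] vertices; the rest of [X] lies in the union. *)
Lemma card_bigcup_nonnbrs_gt S : S \subset X -> clique e S -> 0 < #|S| ->
  #|S| * m < #|\bigcup_(v in S) D v|.
Proof.
move=> sSX cS S_gt0.
have S_le : #|S| <= q by rewrite -ltnS; apply: X_free.
have fN : clique_free e (q - #|S|).+1 (common_nbrs e X S).
  by apply: clique_free_common_nbrs => //; rewrite addnS subnKC.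
have N_le := card_leq (ltac:(lia) : q - #|S| < q) (common_nbrs_sub _ _ _) fN.
have [+ _] := leq_card_setU (common_nbrs e X S) (\bigcup_(v in S) D v).
rewrite -common_nbrs_cover; rewrite mulnBl in N_le.
have := leq_mul S_le (leqnn m); lia.
Qed.

Lemma card_nonnbrs_gt v : v \in X -> m < #|D v|.
Proof.
move=> vX; have := @card_bigcup_nonnbrs_gt [set v].
by rewrite sub1set vX cards1 mul1n big_set1; apply; rewrite ?clique1.
Qed.

(** The union exceeds [2 * m], while the two sizes add up to at most [2 * (m + d)]. *)
Lemma card_nonnbrsI_adj x z : x \in X -> z \in X -> e x z ->
  #|D x :&: D z| < d.*2.
Proof.
move=> xX zX exz; have xz : x != z by apply: contraTneq exz => ->; rewrite e_irr.
have := @card_bigcup_nonnbrs_gt [set x; z].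
rewrite cards2 xz subUset !sub1set xX zX clique2 // big_setU1 ?inE //= big_set1.
move=> /(_ isT isT isT).
have := cardsUI (D x) (D z); have := nonnbrs_leq xX; have := nonnbrs_leq zX.
lia.
Qed.

(* The common neighbourhood of the clique P given by X_max is independent. *)
Lemma card_nonnbrsI_nonadj x y : x \in X -> y \in X -> x != y -> ~~ e x y ->
  m < #|D x :&: D y| + q.-1 * d.
Proof.
move=> xX yX xy nexy.
have [P [sPX cP cardP Px Py]] := X_max xX yX xy nexy.
have fN : clique_free e 2 (common_nbrs e X P).
  by apply: clique_free_common_nbrs => //; rewrite cardP addn2 prednK.
have N_indep := clique_free2_indep e_sym e_irr fN.
have xN : x \in common_nbrs e X P by apply/common_nbrsP.
have yN : y \in common_nbrs e X P by apply/common_nbrsP.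
have sN : common_nbrs e X P \subset D x :&: D y.
  apply/subsetP => z zN; have zX := subsetP (common_nbrs_sub e X P) _ zN.
  by rewrite !inE zX /= !N_indep.
have := subset_leq_card sN.
have : #|\bigcup_(v in P) D v| <= #|P| * (m + d).
  by apply: card_bigcup_nonnbrs => v /(subsetP sPX)/nonnbrs_leq.
have [+ _] := leq_card_setU (common_nbrs e X P) (\bigcup_(v in P) D v).
rewrite -common_nbrs_cover cardP; move: X_gt q_gt0; clear.
case: q => // q'; rewrite /= mulSn mulnDr; lia.
Qed.

(** [D x :&: D y] and [D y :&: D z] each have more than [m - (q - 1) * d] elements inside [D y],
    which has at most [m + d]. So they share at least [2 * d] vertices, too many for adjacent [x]
    and [z]. *)
Lemma nonadj_trans x y z : (q.+1 * d).*2 <= m ->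
  x \in X -> y \in X -> z \in X ->
  x != y -> y != z -> ~~ e x y -> ~~ e y z -> ~~ e x z.
Proof.
move=> d_smaller xX yX zX xy yz nexy neyz; apply/negP => exz.
have xyI := card_nonnbrsI_nonadj xX yX xy nexy.
have yzI := card_nonnbrsI_nonadj yX zX yz neyz.
have xzI := card_nonnbrsI_adj xX zX exz.
have := nonnbrs_leq yX.
have sub : (D x :&: D y) :|: (D y :&: D z) \subset D y.
  by rewrite subUset subsetIr subsetIl.
have := subset_leq_card sub.
have := cardsUI (D x :&: D y) (D y :&: D z).
have : #|(D x :&: D y) :&: (D y :&: D z)| <= #|D x :&: D z|.
  by apply: subset_leq_card; apply: setISS; rewrite ?subsetIl ?subsetIr.
move: xyI yzI xzI d_smaller q_gt0; clear; case: q => // q' /=; lia.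
Qed.

Lemma exists_clique : exists2 Q : {set T}, Q \subset X & clique e Q /\ #|Q| = q.
Proof.
have [/existsP[Q /and3P[sQ cQ /eqP Qq]]|] :=
  boolP [exists Q : {set T}, [&& Q \subset X, clique e Q & #|Q| == q]].
  by exists Q.
rewrite negb_exists => /forallP noQ.
have fX : clique_free e q.-1.+1 X.
  rewrite prednK // => S sS cS; have := X_free sS cS; rewrite ltnS leq_eqVlt.
  by case/orP => // Sq; have := noQ S; rewrite sS cS Sq.
by have := card_leq (ltac:(lia) : q.-1 < q) (subxx X) fX; move: X_gt q_gt0; nia.
Qed.

Lemma exists_nearly_independent_nonnbrs : exists2 v, v \in X &
  exists V R : {set T}, [/\ D v = V :|: R, [disjoint V & R],
    v \in V, {in V &, forall x y, ~~ e x y} & {in V & R, forall x y, ~~ e x y}]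
    /\ [/\ m < #|D v|, #|R| + m.*2 < #|D v|.*2 & (q.+1 * d).*2 <= m -> R = set0].
Proof.
have [Q sQX [cQ cardQ]] := exists_clique.
have QX v : v \in Q -> v \in X by apply: (subsetP sQX).
(* The number of non-neighbours of [u] in [Q], with [u] itself counted if it lies in [Q]. *)
pose mult u := #|Q :&: D u|.
pose R v := [set u in D v | 1 < mult u].
(* If [mult u = 0], then [u |: Q] is a clique of [q + 1] vertices. *)
have mult_gt0 u : u \in X -> 0 < mult u.
  move=> uX; rewrite card_gt0; apply/eqP => mult0.
  have euQ v : v \in Q -> e u v.
    move=> vQ; have : v \notin Q :&: D u by rewrite mult0 inE.
    by rewrite !inE vQ QX //= negbK.
  have uQ : u \notin Q by apply/negP => /euQ; rewrite e_irr.
  have := X_free (S := u |: Q).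
  rewrite cardsU1 uQ cardQ add1n ltnn subUset sub1set uX sQX => /(_ isT) F.
  apply: notF; apply: F; apply: cliqueU; rewrite ?clique1 //.
  by move=> ? ? /set1P->; apply: euQ.
(* Double counting of the non-adjacent pairs between [Q] and [X]. *)
have sum_mult (P : pred T) : \sum_(v in Q) #|[set u in D v | P u]|
    = \sum_(u in X | P u) mult u.
  pose F v u : nat := (u \in D v) && P u.
  transitivity (\sum_(v in Q) \sum_(u in X) F v u).
    apply: eq_bigr => v vQ; rewrite -sum1_card big_mkcond [RHS]big_mkcond /=.
    apply: eq_bigr => u _; rewrite /F !inE.
    by case: (u \in X); case: (e v u); case: (P u).
  rewrite exchange_big /= [RHS]big_mkcondr; apply: eq_bigr => u uX.
  rewrite /mult -sum1_card big_mkcond [in RHS]big_mkcond /=.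
  case: ifP => Pu.
    apply: eq_bigr => v _; rewrite /F !inE uX Pu e_sym.
    by case: (boolP (v \in Q)) => //= vQ; rewrite QX //=; case: (e u v).
  by rewrite big1 // => v _; rewrite /F Pu andbF; case: ifP.
have [v vQ Rv] : exists2 v, v \in Q & #|R v| + m.*2 < #|D v|.*2.
  apply/exists_inP; apply: contraT; rewrite negb_exists => /forallP noV.
  have : \sum_(v in Q) #|D v|.*2 <= \sum_(v in Q) (#|R v| + m.*2).
    by apply: leq_sum => v vQ; have := noV v; rewrite vQ -leqNgt.
  have sumD : \sum_(v in Q) #|D v| = \sum_(u in X) mult u.
    have := sum_mult xpredT; rewrite big_mkcondr /= => <-.
    by apply: eq_bigr => v _; apply: eq_card => u; rewrite !inE andbT.
  have -> : \sum_(v in Q) #|D v|.*2 = (\sum_(u in X) mult u).*2.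
    rewrite -sumD -mul2n big_distrr /=.
    by apply: eq_bigr => v _; rewrite mul2n.
  (* Since [mult u >= 1], doubling [mult u] and subtracting it once when it exceeds 1 leaves at
     least 2. *)
  have : \sum_(u in X | 1 < mult u) mult u + #|X|.*2 <= (\sum_(u in X) mult u).*2.
    rewrite -mul2n -mul2n -sum1_card !big_distrr [\sum_(u in X | _) _]big_mkcondr.
    rewrite -big_split /=; apply: leq_sum => u /mult_gt0; case: ifP; lia.
  rewrite big_split /= sum_nat_const cardQ (sum_mult (fun u => 1 < mult u)) -doubleMr.
  by move: X_gt; clear; lia.
have vX := QX _ vQ.
pose V := [set u in D v | mult u <= 1].
exists v => //; exists V, (R v).
have DVR : D v = V :|: R v.
  by apply/setP => u; rewrite !inE -andb_orr; case: ltnP; rewrite ?orbT ?andbT.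
have vV : v \in V.
  rewrite !inE vX e_irr /=.
  rewrite /mult (_ : Q :&: D v = [set v]) ?cards1 //; apply/setP => u; rewrite !inE.
  case: eqP => [->|/eqP uv]; first by rewrite vQ vX e_irr.
  case: (boolP (u \in Q)) => //= uQ.
  by rewrite (cliqueP _ _ cQ) ?andbF // eq_sym.
have V_adj u w : u \in V -> w \in Q -> w != v -> e u w.
  rewrite !inE => /andP[/andP[uX nevu] multu] wQ wv; apply: contraLR multu => neuw.
  rewrite -ltnNge; have := subset_leq_card (_ : [set v; w] \subset Q :&: D u).
  rewrite cards2 eq_sym wv; apply; rewrite subUset !sub1set !inE.
  by rewrite vQ wQ vX QX //= neuw e_sym nevu.
(* Two adjacent vertices of [V] could replace [v] in [Q], giving a clique of [q + 1] vertices. *)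
have V_indep : {in V &, forall x y, ~~ e x y}.
  move=> x y xV yV; apply/negP => exy.
  have xy : x != y by apply: contraTneq exy => ->; rewrite e_irr.
  have QN z : z \in V -> z \notin Q :\ v.
    rewrite in_setD1 => zV; apply/negP => /andP[zv /(V_adj _ _ zV)-/(_ zv)].
    by rewrite e_irr.
  have VX z : z \in V -> z \in X by rewrite !inE => /andP[/andP[]].
  have cQ' : clique e (y |: (Q :\ v)).
    apply: cliqueU; rewrite ?clique1 ?(clique_sub (subD1set _ _) cQ) //.
    by move=> ? w /set1P-> /setD1P[wv wQ]; apply: V_adj.
  have := X_free (S := x |: (y |: (Q :\ v))).
  have cardQv := cardsD1 v Q; rewrite vQ cardQ in cardQv.
  have xN : x \notin y |: (Q :\ v) by rewrite in_setU1 negb_or xy QN.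
  rewrite !cardsU1 xN QN //= -cardQv !add1n ltnn.
  rewrite !subUset !sub1set !VX // (subset_trans (subD1set _ _) sQX) => /(_ isT) F.
  apply: notF; apply: F; apply: cliqueU; rewrite ?clique1 //.
  by move=> ? w /set1P-> /setU1P[->|/setD1P[wv wQ]] //; apply: V_adj.
have disj : [disjoint V & R v].
  by apply/pred0P => u /=; rewrite !inE; case: ltnP; rewrite ?andbF.
have rv r : r \in R v -> [/\ r \in X, r != v, ~~ e v r & r \notin V].
  move=> rR; have rV : r \notin V by apply/negP => /(disjointFr disj); rewrite rR.
  split=> //.
  - by move: rR; rewrite !inE => /andP[/andP[]].
  - by apply: contraNneq rV => ->.
  - by move: rR; rewrite !inE => /andP[/andP[]].
split; split=> //; last 1 first.
(* A vertex [r] of [R v] misses some [w] of [Q] besides [v]; transitivity through [r] would make [v]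
   and [w] non-adjacent. *)
- move=> d_smaller; apply/setP => r; rewrite in_set0; apply/negP => rR.
  have [rX rneqv nevr _] := rv r rR; move: rR; rewrite inE => /andP[_].
  rewrite /mult (cardsD1 v) !inE vQ vX e_sym nevr /= ltnS => /card_gt0P[w].
  rewrite !inE => /andP[wv /andP[wQ /andP[wX nerw]]].
  have evw : e v w by apply: (cliqueP _ _ cQ); rewrite // eq_sym.
  have vr : v != r by rewrite eq_sym.
  have rw : r != w by apply: contraNneq nevr => ->.
  by have := nonadj_trans d_smaller vX rX wX vr rw nevr nerw; rewrite evw.
(* As [V \subset D x], adjacency leaves fewer than [2 * d] vertices in [V :&: D r], and
   [#|R v| < 2 * d]; yet [D v :&: D r] has more than [m - (q - 1) * d], which is at least
   [4 * d]. *)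
- move=> x r xV rR; apply/negP => exr.
  have [rX rneqv nevr _] := rv r rR.
  have xX : x \in X by move: xV; rewrite !inE => /andP[/andP[]].
  have := card_nonnbrsI_adj xX rX exr.
  have := card_nonnbrsI_nonadj vX rX; rewrite eq_sym => /(_ rneqv nevr).
  have sVx : V \subset D x.
    apply/subsetP => y yV; rewrite inE V_indep // andbT.
    by move: yV; rewrite !inE => /andP[/andP[]].
  have := subset_leq_card (setSI (D r) sVx).
  have : #|D v :&: D r| <= #|V :&: D r| + #|R v|.
    rewrite DVR setIUl; apply: leq_trans (leq_card_setU _ _) _.
    by rewrite leq_add2l subset_leq_card // subsetIl.
  have := nonnbrs_leq vX; move: Rv d_small q_gt0; clear.
  by case: q => // q' /=; lia.
- exact: card_nonnbrs_gt.
Qed.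
End NearlyIndependentNonneighbourhood.

Lemma exists_subset_card (T : finType) (A : {set T}) k :
  k <= #|A| -> exists2 B : {set T}, B \subset A & #|B| = k.
Proof.
move=> kA; exists [set x in take k (enum A)].
  by apply/subsetP => x; rewrite inE => /mem_take; rewrite mem_enum.
by rewrite cardsE (card_uniqP _) ?take_uniq ?enum_uniq // size_takel // -cardE.
Qed.

(** * Packing disjoint copies of [H] among the non-edges of a relation *)

Section Packing.
Variables (T : finType) (e : rel T) (H : sgraph).
Hypothesis e_sym : symmetric e.
Local Notation h := #|H|.
Implicit Types (B V R X Y : {set T}).

(** Edges of [H] go to non-edges of [e], so with injectivity this is containment in the
    complement. *)
Definition embeds B : Prop := exists g : H -> T,
  [/\ injective g, forall x, g x \in B & forall x y, adj x y -> ~~ e (g x) (g y)].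

(* f i is the i-th of k disjoint copies of H; its values for i >= k are junk. *)
Definition packs k B : Prop := exists f : nat -> H -> T,
  [/\ forall i x, i < k -> f i x \in B,
      forall i j x y, i < k -> j < k -> f i x = f j y -> i = j /\ x = y &
      forall i x y, i < k -> adj x y -> ~~ e (f i x) (f i y)].

Lemma packs0 (t0 : T) B : packs 0 B.
Proof. by exists (fun _ _ => t0). Qed.

Lemma packs_sub k B B' : B \subset B' -> packs k B -> packs k B'.
Proof.
by move=> sB [f [fB finj fe]]; exists f; split=> // i x /fB-/(_ x)/(subsetP sB).
Qed.

Lemma packsS k B B' : B' \subset B -> embeds B' -> packs k (B :\: B') -> packs k.+1 B.
Proof.
move=> sB' [g [ginj gB' ge]] [f [fB finj fe]].
have f_lt i : i < k.+1 -> i != k -> i < k by rewrite ltnS leq_eqVlt => /orP[->|].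
have fg i x y : i < k -> f i x <> g y.
  by move=> /fB-/(_ x); rewrite inE => /andP[+ _] fgE; rewrite fgE gB'.
exists (fun i => if i == k then g else f i); split=> [i x|i j x y|i x y].
- case: eqP => [_ _|/eqP ik /f_lt-/(_ ik) /fB-/(_ x)]; first exact: (subsetP sB').
  by rewrite inE => /andP[].
- case: eqP => [-> _|/eqP ik /f_lt-/(_ ik) lik];
  case: eqP => [-> _|/eqP jk /f_lt-/(_ jk) ljk].
  + by move/ginj.
  + by move/esym/(fg _ _ _ ljk).
  + by move/(fg _ _ _ lik).
  + exact: finj.
- by case: eqP => [_ _|/eqP ik /f_lt-/(_ ik) lik]; [apply: ge | apply: fe].
Qed.

Lemma embeds_independent B :
  h = #|B| -> {in B &, forall x y, ~~ e x y} -> embeds B.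
Proof.
move=> hB B_indep; pose g x := enum_val (cast_ord hB (enum_rank x)).
have gB x : g x \in B by apply: enum_valP.
exists g; split=> // [x y|x y _]; last exact: B_indep.
by move/enum_val_inj/cast_ord_inj/enum_rank_inj.
Qed.

(** Copies are removed one at a time. For [k > 0] the bound says [(k - 1) * h + l <= #|Y|]: [l]
    vertices are still available for the last copy. *)
Lemma packs_greedy (t0 : T) l X : {in powerset X, forall Y, l <= #|Y| -> embeds Y} ->
  forall k Y, Y \subset X -> k * h + l <= #|Y| + h -> packs k Y.
Proof.
move=> X_emb; elim=> [|k IHk] Y sY leY; first exact: packs0.
have Y_pow : Y \in powerset X by rewrite powersetE.
have [g [ginj gY ge]] := X_emb Y Y_pow (ltac:(lia)).
have cardB : #|g @: setT| = h by rewrite card_imset // cardsT.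
have sB : g @: setT \subset Y by apply/subsetP => _ /imsetP[x _ ->].
apply: (packsS sB).
  by exists g; split=> // x; apply: imset_f.
apply: IHk; first exact: subset_trans (subsetDl _ _) sY.
by rewrite cardsD (setIidPr sB) cardB; have := subset_leq_card sB; lia.
Qed.

(* At most one vertex of R goes into each copy of H. *)
Lemma packs_nearly_independent (t0 : T) k V R : 0 < h -> [disjoint V & R] ->
  {in V &, forall x y, ~~ e x y} -> {in V & R, forall x y, ~~ e x y} ->
  irreflexive e -> k * h <= #|V| + #|R| -> #|R| <= k -> packs k (V :|: R).
Proof.
move=> h_gt0 + + + e_irr.
elim: k V R => [|k IHk] V R dVR V_indep VR leVR leR; first exact: packs0.
have [R1 sR1 [R1_le R1_ge]] : exists2 R1 : {set T}, R1 \subset R &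
    #|R1| <= 1 /\ #|R| <= #|R1| + k.
  have [->|[r rR]] := set_0Vmem R; first by exists set0; rewrite ?cards0.
  by exists [set r]; rewrite ?sub1set ?cards1.
(* Enough of [V] is left: [#|R| <= k + 1] gives [#|V| >= (k + 1) * (h - 1)], and if [R1] is empty
   then [#|R| <= k]. *)
have [V1 sV1 cardV1] : exists2 V1 : {set T}, V1 \subset V & #|V1| = h - #|R1|.
  by apply: exists_subset_card; nia.
have dVR1 : [disjoint V1 & R1] by apply: disjointW dVR.
have indep1 : {in V1 :|: R1 &, forall x y, ~~ e x y}.
  have sV1P := subsetP sV1; have sR1P := subsetP sR1.
  move=> x y /setUP[xV|xR] /setUP[yV|yR].
  - by apply: V_indep; apply: sV1P.
  - by apply: VR; [apply: sV1P | apply: sR1P].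
  - by rewrite e_sym; apply: VR; [apply: sV1P | apply: sR1P].
  - by rewrite (card_le1_eqP R1_le x y) ?e_irr.
apply: (@packsS _ _ (V1 :|: R1)); first exact: setUSS.
  apply: embeds_independent => //.
  by rewrite cardsU (disjoint_setI0 dVR1) cards0 cardV1; lia.
have -> : (V :|: R) :\: (V1 :|: R1) = (V :\: V1) :|: (R :\: R1).
  apply/setP => x; rewrite !inE.
  have /implyP := subsetP sV1 x; have /implyP := subsetP sR1 x.
  have : ~~ ((x \in V) && (x \in R)) by apply/negP => /andP[/(disjointFr dVR)->].
  by case: (x \in V1) (x \in R1) (x \in V) (x \in R) => [] [] [] [].
apply: IHk.
- by apply: disjointW dVR; apply: subsetDl.
- by move=> x y /setDP[xV _] /setDP[yV _]; apply: V_indep.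
- by move=> x y /setDP[xV _] /setDP[yR _]; apply: VR.
- rewrite !cardsD (setIidPr sV1) (setIidPr sR1).
  have := subset_leq_card sV1; have := subset_leq_card sR1; lia.
- by rewrite cardsD (setIidPr sR1); lia.
Qed.
End Packing.

(** * Adding an edge, for the passage to an edge-maximal relation *)

Lemma packs_subrel (T : finType) (e e' : rel T) (H : sgraph) k (B : {set T}) :
  subrel e e' -> packs e' H k B -> packs e H k B.
Proof.
move=> ee' [f [fB finj fe]]; exists f; split=> // i x y ik xy.
by apply: contra (fe i x y ik xy); apply: ee'.
Qed.

Definition add_edge (T : finType) (e : rel T) (x y : T) : rel T := fun u v =>
  [|| e u v, (u == x) && (v == y) | (u == y) && (v == x)].

Section AddEdge.
Variables (T : finType) (e : rel T) (x y : T).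
Hypotheses (e_sym : symmetric e) (e_irr : irreflexive e).

Lemma add_edge_sym : symmetric (add_edge e x y).
Proof.
move=> u v; rewrite /add_edge e_sym.
by rewrite [(v == x) && _]andbC [(v == y) && _]andbC [X in _ || X]orbC.
Qed.

Lemma add_edge_irr : x != y -> irreflexive (add_edge e x y).
Proof.
move=> xy u; rewrite /add_edge e_irr /=; apply/norP.
by split; apply: contraNN xy => /andP[/eqP<- /eqP<-].
Qed.

(** The measure that decreases when an edge is added. *)
Lemma card_nonedges_add_edge : ~~ e x y ->
  #|[set z : T * T | ~~ add_edge e x y z.1 z.2]| < #|[set z : T * T | ~~ e z.1 z.2]|.
Proof.
move=> nexy; apply/proper_card/properP; split.
  by apply/subsetP => z; rewrite !inE /add_edge => /norP[].
by exists (x, y); rewrite !inE //= /add_edge !eqxx orbT.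
Qed.

(** A clique using the new edge contains both its ends; the rest of it supplies the set [P] that
    edge-maximality asks for. *)
Lemma clique_add_edge (S : {set T}) : clique (add_edge e x y) S ->
  clique e S \/ [/\ x \in S, y \in S, clique e (S :\: [set x; y]) &
    {in S :\: [set x; y], forall v, e v x /\ e v y}].
Proof.
move=> /cliqueP cS.
have [/andP[xS yS]|nS] := boolP ((x \in S) && (y \in S)); [right | left].
  have S' u : u \in S :\: [set x; y] -> [/\ u \in S, u != x & u != y].
    by rewrite !inE negb_or => /andP[/andP[]].
  split=> //.
    apply/cliqueP => u v /S'[uS ux uy] /S'[vS _ _] /(cS u v uS vS).
    by rewrite /add_edge (negbTE ux) (negbTE uy) !orbF.
  move=> u /S'[uS ux uy]; move: (cS u x uS xS ux) (cS u y uS yS uy).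
  by rewrite /add_edge (negbTE ux) (negbTE uy) !orbF.
apply/cliqueP => u v uS vS uv; have /or3P[] // := cS u v uS vS uv.
  by case/andP=> /eqP ux /eqP vy; rewrite -ux -vy uS vS in nS.
by case/andP=> /eqP uy /eqP vx; rewrite -uy -vx uS vS in nS.
Qed.

End AddEdge.

(** * The upper bound: a vertex with a packing among its non-neighbours *)

Section UpperBound.
Variables (T : finType) (H : sgraph) (p n l : nat).
Local Notation h := #|H|.
Local Notation m := (n * h).
Hypotheses (h_gt0 : 0 < h) (h_le : h <= l).
Hypothesis embH : forall (e : rel T) (Y : {set T}), symmetric e -> irreflexive e ->
  clique_free e p Y -> l <= #|Y| -> embeds e H Y.
Hypothesis n_large : 2 * p * l <= m \/ (p + 2) * l <= m /\ l <= n + h.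

(** Strong induction on [q], then on the number of non-edges; the inner induction stands in for the
    choice of an edge-maximal relation. *)
Lemma exists_packs_nonnbrs q (e : rel T) (X : {set T}) :
  q < p -> symmetric e -> irreflexive e -> clique_free e q.+1 X -> q * m < #|X| ->
  exists2 v, v \in X & packs e H n (nonnbrs e X v :\ v).
Proof.
elim/ltn_ind: q e X => q IHq e X qp.
have [N] := ubnP #|[set z : T * T | ~~ e z.1 z.2]|; elim: N e => // N IHN e leN.
move=> e_sym e_irr X_free X_gt.
have [//|noX] := pselect (exists2 v, v \in X & packs e H n (nonnbrs e X v :\ v)).
have [q0|q_gt0] := posnP q.
  have /card_gt0P[v vX] : 0 < #|X| by apply: leq_trans X_gt.
  by have := X_free [set v]; rewrite sub1set vX clique1 cards1 q0 => /(_ isT isT).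
(* Otherwise greedy packing finds [n] copies even after [v] is removed. *)
have nonnbrs_le : {in X, forall v, #|nonnbrs e X v| <= m + (l - h)}.
  move=> v vX; rewrite leqNgt; apply/negP => D_gt; apply: noX; exists v => //.
  have sDX : nonnbrs e X v :\ v \subset X.
    by apply/subsetP => u; rewrite !inE => /and3P[].
  apply: (packs_greedy v (l := l) (X := X)) => //.
    move=> Y; rewrite powersetE => sYX; apply: embH => //.
    exact: clique_free_sub sYX (clique_free_leq qp X_free).
  by have := cardsD1 v (nonnbrs e X v); rewrite mem_nonnbrs_self //; lia.
have card_le k (Y : {set T}) : k < q -> Y \subset X -> clique_free e k.+1 Y ->
    #|Y| <= k * m.
  move=> kq sYX Y_free; rewrite leqNgt; apply/negP => Y_gt.
  have [v vY] := IHq k kq e Y (ltn_trans kq qp) e_sym e_irr Y_free Y_gt.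
  move=> packY; apply: noX; exists v; first exact: (subsetP sYX).
  apply: packs_sub packY; apply: setSD; apply/subsetP => u.
  by rewrite !inE => /andP[/(subsetP sYX)->].
have X_max : {in X &, forall x y, x != y -> ~~ e x y ->
  exists P : {set T}, [/\ P \subset X, clique e P, #|P| = q.-1,
    {in P, forall v, e v x} & {in P, forall v, e v y}]}.
  move=> x y xX yX xy nexy.
  (* If the edge could be added, the induction on non-edges would give a packing, which survives the
     removal of the edge. *)
  have [e'_free|] := pselect (clique_free (add_edge e x y) q.+1 X).
    have sub_e : subrel e (add_edge e x y) by move=> u v; rewrite /add_edge => ->.
    have leN' := leq_trans (card_nonedges_add_edge nexy) (ltnSE leN).
    have [v vX packv] := IHN _ leN' (add_edge_sym _ _ e_sym)
      (add_edge_irr e_irr xy) e'_free X_gt.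
    case: noX; exists v => //; apply: (packs_subrel sub_e); apply: packs_sub packv.
    apply: setSD; apply/subsetP => u; rewrite !inE => /andP[->].
    by apply: contraNN; apply: sub_e.
  move=> e'_nfree; apply: contrapT => noP; apply: e'_nfree => S sSX cS.
  case: (clique_add_edge cS) => [|[xS yS cS' S'xy]]; first exact: X_free.
  rewrite ltnNge; apply/negP => S_gt; apply: noP.
  have cardS' : q.-1 <= #|S :\: [set x; y]|.
    have := cardsID [set x; y] S; rewrite (setIidPr _) ?cards2 ?xy; first by lia.
    by rewrite subUset !sub1set xS.
  have [P sPS' cardP] := exists_subset_card cardS'.
  exists P; split=> //; rewrite ?(clique_sub sPS' cS') //.
  - exact: subset_trans sPS' (subset_trans (subsetDl _ _) sSX).
  - by move=> v /(subsetP sPS')/S'xy[].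
  - by move=> v /(subsetP sPS')/S'xy[].
(* [q < p] gives [q + 3 <= p + 2], and [p + 2 <= 2 * p] because [0 < q < p]. *)
have d_small : q.+3 * (l - h) <= m.
  apply: (@leq_trans (q.+3 * l)); first by rewrite leq_mul2l leq_subr.
  by case: n_large => [|[]]; nia.
have [v vX [V [R [[DVR dVR vV V_indep VR] [D_gt R_lt R0]]]]] :=
  exists_nearly_independent_nonnbrs e_sym e_irr q_gt0 X_free X_gt nonnbrs_le
    card_le X_max d_small.
(* Under the first condition [R] is empty. Under the second, when [#|R| > n], the bounds give
   [#|V| > m - (l - h)], so [n] vertices of [R] suffice because [n >= l - h]. *)
have [R' sR' [R'_le R'_ge]] : exists2 R' : {set T}, R' \subset R &
    #|R'| <= n /\ m < #|V| + #|R'|.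
  have cardD : #|nonnbrs e X v| = #|V| + #|R|.
    by rewrite DVR cardsU disjoint_setI0 // cards0 subn0.
  case: n_large => [n_large1|[_ l_le]].
    rewrite R0 in cardD *; last by nia.
    by exists set0; rewrite // -cardD cards0.
  have [R_le|n_lt] := leqP #|R| n; first by exists R; rewrite // -cardD.
  have [R' sR' cardR'] := exists_subset_card (ltnW n_lt).
  by exists R'; rewrite // cardR'; have := nonnbrs_le v vX; lia.
case: noX; exists v => //.
apply: (@packs_sub _ _ _ _ (V :\ v :|: R')).
  have dvR : v \notin R by rewrite (disjointFr dVR vV).
  rewrite DVR setDUl setUS // subsetD1 sR' /=.
  by apply: contra dvR; apply: (subsetP sR').
have sVv := subsetP (subsetDl V [set v]).
apply: packs_nearly_independent => //.
- exact: disjointW (subsetDl _ _) sR' dVR.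
- by move=> x y /sVv xV /sVv yV; apply: V_indep.
- by move=> x y /sVv xV /(subsetP sR') yR; apply: VR.
(* The strict inequality [m < #|V| + #|R'|] pays for the removal of [v]. *)
- by have := cardsD1 v V; rewrite vV; lia.
Qed.

End UpperBound.

(** * From relations back to graphs and Ramsey numbers *)

Lemma embeds_of_arrows p l (H : sgraph) (T : finType) (e : rel T) (Y : {set T}) :
  arrows (complete p) H l -> symmetric e -> irreflexive e ->
  clique_free e p Y -> l <= #|Y| -> embeds e H Y.
Proof.
move=> arrH e_sym e_irr Y_free lY.
(* [arrows] concerns graphs on exactly [l] vertices, so [e] is pulled back along [l] elements of
   [Y]. *)
pose f (i : 'I_l) := enum_val (widen_ord lY i).
have f_inj : injective f by move=> i j /enum_val_inj/(congr1 val)/= /val_inj.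
have fY i : f i \in Y by apply: enum_valP.
have ef_sym : symmetric (fun i j => e (f i) (f j)) by move=> i j; apply: e_sym.
have ef_irr : irreflexive (fun i j => e (f i) (f j)) by move=> i; apply: e_irr.
have [[g g_inj ge]|[g g_inj ge]] := arrH (SGraph ef_sym ef_irr) (card_ord l).
  have := Y_free [set f (g i) | i : 'I_p].
  rewrite card_imset ?card_ord ?ltnn; last by move=> i j /f_inj/g_inj.
  move=> F; exfalso; apply: notF; apply: F.
    by apply/subsetP => _ /imsetP[i _ ->].
  apply/cliqueP => _ _ /imsetP[i _ ->] /imsetP[j _ ->] ij; apply: ge.
  by apply: contraNneq ij => ->.
exists (fun x => f (g x)); split=> // [x y /f_inj/g_inj //|x y xy].
by have /andP[] := ge x y xy.
Qed.

(** The edgeless graph on [l] vertices has no clique of [p > 1] vertices, so its complement must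
    contain [H]. *)
Lemma leq_card_arrows p l (H : sgraph) : 1 < p ->
  arrows (complete p) H l -> #|H| <= l.
Proof.
move=> p_gt1 arrH.
have free : clique_free (fun _ _ : 'I_l => false) p setT.
  move=> S _ /cliqueP cS; apply: leq_trans p_gt1; rewrite ltnS.
  by apply/card_le1_eqP => x y xS yS; apply/eqP; apply: contraT; exact: cS.
have [//|//||g [g_inj _ _]] := embeds_of_arrows arrH _ _ free.
  by rewrite cardsT card_ord.
by rewrite -[l]card_ord; apply: leq_card g_inj.
Qed.

Lemma ramsey_numberP (G1 G2 : sgraph) : 0 < ramsey_number G1 G2 /\
  arrows G1 G2 (ramsey_number G1 G2).
Proof. by rewrite /ramsey_number; case: ex_minnP => N /andP[N_gt0 /asboolP]. Qed.

Lemma ramsey_number_leq (G1 G2 : sgraph) N :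
  0 < N -> arrows G1 G2 N -> ramsey_number G1 G2 <= N.
Proof.
move=> N_gt0 arrN; rewrite /ramsey_number; case: ex_minnP => N' _; apply.
by rewrite /is_ramsey N_gt0; apply/asboolP.
Qed.

Lemma card_cone_copies n (H : sgraph) : #|cone (copies n H)| = (n * #|H|).+1.
Proof. by rewrite card_option card_prod card_ord. Qed.

(* The complete q-partite graph with parts of size at most n * #|H|. *)
Lemma not_arrows_cone q n (H : sgraph) N : N <= q * (n * #|H|) ->
  0 < n * #|H| -> ~ arrows (complete q.+1) (cone (copies n H)) N.
Proof.
set m := n * #|H| => N_le m_gt0.
pose e (i j : 'I_N) := i %/ m != j %/ m.
have e_sym : symmetric e by move=> i j; rewrite /e eq_sym.
have e_irr : irreflexive e by move=> i; rewrite /e eqxx.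
move=> /(_ (SGraph e_sym e_irr) (card_ord N))[[f f_inj fe]|[f f_inj fe]].
  have f_lt i : f i %/ m < q.
    by rewrite ltn_divLR //; apply: leq_trans (ltn_ord _) N_le.
  have g_inj : injective (fun i => Ordinal (f_lt i)).
    move=> i j [fij]; apply/eqP; apply: contraT => ij.
    by have := fe i j ij; rewrite /= /e fij eqxx.
  by have := leq_card _ g_inj; rewrite !card_ord ltnn.
(* The whole cone lies in the part of its apex, which has at most [m] vertices, one too few. *)
have f_div z : f z %/ m = f None %/ m.
  case: z => [z|//]; have := fe None (Some z) isT.
  by rewrite /= /compl_adj /= /e negbK => /andP[_ /eqP].
have f_lt z : f z %% m < m by rewrite ltn_mod.
have g_inj : injective (fun z => Ordinal (f_lt z)).
  move=> x y [fxy]; apply: f_inj; apply: val_inj.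
  by rewrite /= (divn_eq (f x) m) (divn_eq (f y) m) !f_div fxy.
by have := leq_card _ g_inj; rewrite card_cone_copies card_ord ltnn.
Qed.

Lemma arrows_cone p n l (H : sgraph) : 0 < p -> 0 < #|H| ->
  arrows (complete p) H l ->
  2 * p * l <= n * #|H| \/ (p + 2) * l <= n * #|H| /\ l <= n + #|H| ->
  arrows (complete p) (cone (copies n H)) (p.-1 * (n * #|H|)).+1.
Proof.
move=> p_gt0 h_gt0 arrH n_large G cardG.
have [|noK] := pselect (contains G (complete p)); [by left | right].
have G_free : clique_free (@adj G) p setT.
  move=> S _ cS; rewrite ltnNge; apply/negP => pS; apply: noK.
  have [B sBS cardB] := exists_subset_card pS.
  apply: (@contains_clique _ _ B); first by rewrite cardB card_ord.
  exact/cliqueP/(clique_sub sBS).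
(* The case [p = 1] is separate because [leq_card_arrows] requires [p > 1]; any vertex is then a
   [K_1]. *)
have [p1|p_gt1] : p = 1 \/ 1 < p by lia.
  case: noK; subst p; have /card_gt0P[v _] : 0 < #|G| by rewrite cardG.
  exists (fun=> v) => [i j _|i j]; first by rewrite !ord1.
  by rewrite !ord1 adj_irrefl.
have emb (e : rel G) Y : symmetric e -> irreflexive e ->
  clique_free e p Y -> l <= #|Y| -> embeds e H Y by apply: embeds_of_arrows.
have h_le := leq_card_arrows p_gt1 arrH.
have [|||v _ [f [fD f_inj fe]]] := exists_packs_nonnbrs (q := p.-1) (X := setT)
  h_gt0 h_le emb n_large _ (@adj_sym G) (@adj_irrefl G); rewrite ?prednK //.
  by rewrite cardsT cardG.
have fN (z : 'I_n * H) : f z.1 z.2 != v /\ ~~ adj v (f z.1 z.2).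
  by have := fD z.1 z.2 (ltn_ord _); rewrite !inE => /andP[].
have f_inj' (z z' : 'I_n * H) : f z.1 z.2 = f z'.1 z'.2 -> z = z'.
  case: z z' => [i x] [j y] /f_inj-/(_ (ltn_ord _) (ltn_ord _))/= [ij ->].
  by rewrite (val_inj ij).
exists (fun z : cone (copies n H) => if z is Some (i, x) then f i x else v).
  move=> [[i x]|] [[j y]|] //=.
  - by move/(f_inj' (i, x) (j, y)) ->.
  - by move=> fv; have [] := fN (i, x); rewrite fv eqxx.
  - by move=> vf; have [] := fN (j, y); rewrite -vf eqxx.
move=> [[i x]|] [[j y]|] //=; rewrite /compl_adj.
- rewrite /copies_adj /= => /andP[/eqP <- xy]; rewrite fe // andbT.
  by apply: contraTneq xy => /(f_inj' (i, x) (i, y))[->]; rewrite adj_irrefl.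
- by move=> _; rewrite adj_sym; apply/andP; have [] := fN (i, x).
- by move=> _; rewrite eq_sym; apply/andP; have [] := fN (j, y).
Qed.

Lemma connected_cone (G : sgraph) : connected (cone G).
Proof.
split=> [|x y]; first by rewrite card_option.
by apply: (@connect_trans _ _ None); [case: x => [x|] | case: y => [y|]];
  rewrite ?connect0 ?connect1.
Qed.

Theorem theorem3 (p n : nat) (H : sgraph) (h l : nat)
  (hp : (0 < p)%N) (hn : (0 < n)%N)
  (hh : h = #|H|) (h_gt0 : (1 <= h)%N)
  (hl : l = ramsey_number (complete p) H)
  (hcond :
    ((2 * p * l)%N%:R / h%:R <= n%:R :> rat)%R \/
    (Num.max (((p + 2) * l)%N%:R / h%:R) (l%:R - h%:R) <= n%:R :> rat)%R) :
  p_good p (cone (copies n H)) /\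
  ramsey_number (complete p) (cone (copies n H)) = ((p - 1) * (n * h) + 1)%N.
Proof.
have [_ arrH] := ramsey_numberP (complete p) H; rewrite -hl in arrH.
have h_gt0R : (0 < h%:R :> rat)%R by rewrite ltr0n.
(* Multiplying by [h > 0] and moving [h] across turns the rational conditions into natural-number
   ones. *)
have n_large : 2 * p * l <= n * h \/ (p + 2) * l <= n * h /\ l <= n + h.
  case: hcond => hcond; [left | right].
    by rewrite ler_pdivrMr // -natrM ler_nat in hcond.
  by move: hcond; rewrite ge_max ler_pdivrMr // -natrM lerBlDr -natrD !ler_nat => /andP.
have eq_ramsey : ramsey_number (complete p) (cone (copies n H)) = (p - 1) * (n * h) + 1.
  rewrite hh in h_gt0 n_large *; rewrite subn1 addn1; apply/eqP; rewrite eqn_leq.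
  rewrite ramsey_number_leq //=; last exact: arrows_cone arrH n_large.
  have [_] := ramsey_numberP (complete p) (cone (copies n H)).
  move: (ramsey_number _ _) => N; rewrite ltnNge -{1}(prednK hp) => arrN.
  apply/negP => N_le; apply: not_arrows_cone N_le _ arrN.
  by rewrite muln_gt0 hn.
split=> //; split; first exact: connected_cone.
by rewrite eq_ramsey card_cone_copies hh subn1.
Qed.
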